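(* Let $\nu\ge 1$ be an integer. The automorphism group of the graph $Sp(2\nu,2)$ is isomorphic to the symplectic group of degree $2\nu$ over $\mathbb{F}_2$: $$\mathrm{Aut}(Sp(2\nu,2))\cong Sp_{2\nu}(\mathbb{F}_2).$$
   Context: For a prime power $q$, let $\mathbb{F}_q^{(2\nu)}$ be the $2\nu$-dimensional space of row vectors over the finite field $\mathbb{F}_q$. Let $K$ be the $2\nu\times 2\nu$ block diagonal matrix over $\mathbb{F}_q$ with $\nu$ diagonal blocks all equal to $\begin{pmatrix}0&1\\-1&0\end{pmatrix}$. For a nonzero row vector $\alpha$, $[\alpha]$ denotes the one-dimensional subspace spanned by $\alpha$. The symplectic graph $Sp(2\nu,q)$ is the simple undirected graph whose vertices are the one-dimensional subspaces of $\mathbb{F}_q^{(2\nu)}$, with $[\alpha]$ adjacent to $[\beta]$ if and only if $\alpha K\,{}^t\!\beta\neq 0$ (where ${}^t\!\beta$ is the transpose of $\beta$). $\mathrm{Aut}(Sp(2\nu,q))$ is its group of graph automorphisms. The symplectic group $Sp_{2\nu}(\mathbb{F}_q)$ is the group of all $2\nu\times 2\nu$ matrices $T$ over $\mathbb{F}_q$ with $T K\,{}^t T=K$, under matrix multiplication. Here $q=2$. *)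

(* Defs.v *)
From HB Require Import structures.
From mathcomp Require Import all_boot all_order all_fingroup all_algebra.

Set Implicit Arguments.
Unset Strict Implicit.
Unset Printing Implicit Defensive.

Import GRing.Theory.
Local Open Scope ring_scope.

(* {vspace vT} is only a choiceType in the library; over a finite field it is
   finite. *)
Section FiniteVspace.
Variables (F : finFieldType) (vT : vectType F).
Let vs2mx (U : {vspace vT}) : 'M[F]_(dim vT) := VectorInternalTheory.vs2mx U.
Let vs2mxK : cancel vs2mx VectorInternalTheory.mx2vs.
Proof. exact: VectorInternalTheory.vs2mxK. Qed.
HB.instance Definition _ := isCountable.Build {vspace vT}
  (pcan_pickleK (can_pcan vs2mxK)).
HB.instance Definition _ := isFinite.Build {vspace vT}
  (pcan_enumP (can_pcan vs2mxK)).
End FiniteVspace.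

Section GraphAutomorphisms.
Variables (T : finType) (e : rel T).

Definition graph_aut : {set {perm T}} :=
  [set s : {perm T} | [forall x, forall y, e (s x) (s y) == e x y]].

Lemma graph_autP (s : {perm T}) :
  reflect (forall x y, e (s x) (s y) = e x y) (s \in graph_aut).
Proof.
rewrite inE; apply: (iffP forallP) => [h x y|h x].
  by apply/eqP; exact: (forallP (h x) y).
by apply/forallP => y; rewrite h.
Qed.

Lemma graph_aut_group_set : group_set graph_aut.
Proof.
apply/group_setP; split=> [|s t /graph_autP hs /graph_autP ht].
  by apply/graph_autP => x y; rewrite !perm1.
by apply/graph_autP => x y; rewrite !permM ht hs.
Qed.

Canonical graph_aut_group := Group graph_aut_group_set.
End GraphAutomorphisms.

Section Symplectic.
Variables (F : finFieldType) (nu : nat).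

Definition symp_block : 'M[F]_2 := block_mx 0 1 (-1) 0 : 'M[F]_(1 + 1).

Lemma symp_size : (\sum_(i < nu) 2 = 2 * nu)%N.
Proof. by rewrite sum_nat_const card_ord mulnC. Qed.

(* The cast only identifies the size \sum_(i < nu) 2 of a block diagonal
   matrix with 2 * nu. *)
Definition symp_mx : 'M[F]_(2 * nu) :=
  castmx (symp_size, symp_size) (\mxdiag_(i < nu) symp_block).

Lemma symp_block_tr : symp_block^T = - symp_block.
Proof.
rewrite /symp_block (tr_block_mx (0 : 'M[F]_1)) (opp_block_mx (0 : 'M[F]_1)).
by rewrite !raddfN /= !raddf0 !opprK /= tr_scalar_mx.
Qed.

Lemma symp_block_sqr : symp_block *m symp_block = - 1%:M.
Proof.
pose J : 'M[F]_(1 + 1) := block_mx 0 1 (-1) 0.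
have JJ : J *m J = - 1%:M.
  rewrite mulmx_block (scalar_mx_block 1 1 1) opp_block_mx.
  by rewrite !mul0mx !mulmx0 !addr0 !add0r !oppr0 mulmx1 mul1mx.
exact: JJ.
Qed.

Lemma symp_mx_tr : symp_mx^T = - symp_mx.
Proof.
rewrite /symp_mx; case: _ / symp_size; rewrite castmx_id tr_mxdiag -mxdiagN.
by apply: eq_mxdiag => i; rewrite symp_block_tr.
Qed.

Lemma symp_mx_sqr : symp_mx *m symp_mx = - 1%:M.
Proof.
rewrite /symp_mx; case: _ / symp_size; rewrite castmx_id mul_mxdiag_mxblock.
rewrite -(mxdiagZ (p_ := fun=> 2%N)) -mxdiagN /mxdiag; apply: eq_mxblock => i j.
case: (eqVneq i j) => [_|_]; first by rewrite !conform_mx_id symp_block_sqr.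
by rewrite mulmx0.
Qed.

Lemma symp_mx_alt (a : 'rV[F]_(2 * nu)) : a *m symp_mx *m a^T = 0.
Proof.
pose B : 'M[F]_(1 + 1) := block_mx 0 1 0 0.
have eB : symp_block = B - B^T.
  have: block_mx 0 1 (-1) 0 = B - B^T; last by [].
  rewrite tr_block_mx opp_block_mx add_block_mx !trmx0 trmx1.
  by rewrite !oppr0 !addr0 add0r.
have [D ->] : exists D : 'M[F]_(2 * nu), symp_mx = D - D^T.
  exists (castmx (symp_size, symp_size) (\mxdiag_(i < nu) B)).
  rewrite /symp_mx; case: _ / symp_size; rewrite !castmx_id tr_mxdiag -mxdiagB.
  by apply: eq_mxdiag.
apply/matrixP => i j; rewrite !ord1 mulmxBr mulmxBl.
have -> : a *m D^T *m a^T = (a *m D *m a^T)^T by rewrite !trmx_mul trmxK mulmxA.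
by rewrite !mxE subrr.
Qed.

Definition symp_vertex : finType :=
  {U : {vspace 'rV[F]_(2 * nu)} | \dim U == 1%N}.

Definition symp_adj : rel symp_vertex := fun U V =>
  [exists a : 'rV[F]_(2 * nu), exists b : 'rV[F]_(2 * nu),
    [&& a != 0, b != 0, val U == <[a]>%VS, val V == <[b]>%VS
      & a *m symp_mx *m b^T != 0]].

(* Adjacency does not depend on the chosen spanning vectors. *)
Lemma symp_adjE (U V : symp_vertex) (a b : 'rV[F]_(2 * nu)) :
  val U = <[a]>%VS -> val V = <[b]>%VS ->
  symp_adj U V = (a *m symp_mx *m b^T != 0).
Proof.
move=> Ua Vb.
have nz (W : symp_vertex) c : val W = <[c]>%VS -> c != 0.
  by move=> Wc; move: (valP W); rewrite /= Wc dim_vline; case: (c != 0).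
apply/idP/idP => [|h]; last first.
  apply/existsP; exists a; apply/existsP; exists b.
  by rewrite (nz U) ?(nz V) ?Ua ?Vb ?eqxx.
case/existsP=> a' /existsP[b'] /and5P[_ _ /eqP Ua' /eqP Vb' h].
have /vlineP[k ka] : a' \in <[a]>%VS by rewrite -Ua Ua' memv_line.
have /vlineP[l lb] : b' \in <[b]>%VS by rewrite -Vb Vb' memv_line.
apply: contra h => /eqP h.
by rewrite ka lb linearZ /= -!scalemxAl -scalemxAr h !scaler0.
Qed.

Lemma symp_vertexP (U : symp_vertex) :
  exists2 a : 'rV[F]_(2 * nu), a != 0 & val U = <[a]>%VS.
Proof.
have dU := eqP (valP U); exists (vpick (val U)).
  by rewrite vpick0 -dimv_eq0 dU.
apply/esym/eqP; rewrite eqEdim -memvE memv_pick dim_vline vpick0 -dimv_eq0.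
by rewrite dU.
Qed.

Lemma symp_adj_irr : irreflexive symp_adj.
Proof.
move=> U; have [a _ Ua] := symp_vertexP U.
by rewrite (symp_adjE Ua Ua) symp_mx_alt eqxx.
Qed.

Lemma symp_adj_sym : symmetric symp_adj.
Proof.
move=> U V; have [a _ Ua] := symp_vertexP U; have [b _ Vb] := symp_vertexP V.
rewrite (symp_adjE Ua Vb) (symp_adjE Vb Ua).
rewrite -(inj_eq (@trmx_inj _ _ _)) trmx0 !trmx_mul trmxK symp_mx_tr.
by rewrite mulNmx mulmxN oppr_eq0 mulmxA.
Qed.

Definition symplectic_pred : pred 'M[F]_(2 * nu) :=
  fun T => T *m symp_mx *m T^T == symp_mx.

(* A dedicated finGroupType rather than a subgroup of {'GL_(2 * nu)[F]}, whose
   matrices have the non-convertible size (2 * nu).-1.+1. *)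
Record symplectic := Symplectic {
  symplectic_val :> 'M[F]_(2 * nu);
  _ : symplectic_pred symplectic_val }.

HB.instance Definition _ := [isSub for symplectic_val].
HB.instance Definition _ := [Finite of symplectic by <:].

Lemma symplectic_unit (T : symplectic) : symplectic_val T \in unitmx.
Proof.
have /eqP hT := valP T.
have h : val T *m (symp_mx *m (val T)^T *m (- symp_mx)) = 1%:M.
  by rewrite !mulmxA hT mulmxN symp_mx_sqr opprK.
by have [] := mulmx1_unit h.
Qed.

Fact symplectic_one_subproof : symplectic_pred 1%:M.
Proof. by rewrite /symplectic_pred mul1mx trmx1 mulmx1. Qed.

Fact symplectic_mul_subproof (S T : symplectic) :
  symplectic_pred (val S *m val T).
Proof.
have /eqP hS := valP S; have /eqP hT := valP T.
rewrite /symplectic_pred trmx_mul -!mulmxA (mulmxA symp_mx) (mulmxA (val T)).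
by rewrite (mulmxA (val T)) hT mulmxA hS.
Qed.

Fact symplectic_inv_subproof (T : symplectic) :
  symplectic_pred (invmx (val T)).
Proof.
have /eqP hT := valP T; have uT := symplectic_unit T.
apply/eqP; set M := val T in hT uT *.
have {1}<- : M *m symp_mx *m M^T = symp_mx := hT.
by rewrite !mulmxA mulVmx // mul1mx -mulmxA -trmx_mul mulVmx // trmx1 mulmx1.
Qed.

Definition symplectic_one := Symplectic symplectic_one_subproof.
Definition symplectic_mul S T := Symplectic (symplectic_mul_subproof S T).
Definition symplectic_inv T := Symplectic (symplectic_inv_subproof T).

Fact symplectic_mulA : associative symplectic_mul.
Proof. by move=> R S T; apply: val_inj; rewrite /= mulmxA. Qed.
Fact symplectic_mul1 : left_id symplectic_one symplectic_mul.
Proof. by move=> T; apply: val_inj; rewrite /= mul1mx. Qed.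
Fact symplectic_mulV : left_inverse symplectic_one symplectic_inv symplectic_mul.
Proof.
by move=> T; apply: val_inj; rewrite /= mulVmx //; exact: symplectic_unit.
Qed.

HB.instance Definition _ := Finite_isGroup.Build symplectic
  symplectic_mulA symplectic_mul1 symplectic_mulV.

End Symplectic.

(* Main.v *)
Require Import Defs.
From HB Require Import structures.
From mathcomp Require Import all_boot all_order all_fingroup all_algebra.

(** Over [F_2] a line has a single nonzero vector, so an automorphism of the
graph is the same thing as a bijection [g] of the whole space that fixes [0]
and preserves the symplectic form [B].  Such a [g] is linear: the vector
[g (a + b) - g a - g b] is [B]-orthogonal to every [g c], that is to
everything, hence vanishes by nondegeneracy. *)

Set Implicit Arguments.
Unset Strict Implicit.
Unset Printing Implicit Defensive.

Import GRing.Theory.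
Local Open Scope ring_scope.

Section SymplecticAction.
Variables (F : finFieldType) (nu : nat).
Local Notation V := 'rV[F]_(2 * nu).
Local Notation K := (symp_mx F nu).
Local Notation vertex := (symp_vertex F nu).
Implicit Types (T : symplectic F nu) (U : vertex) (a b : V).

(** Pairing with the standard basis gives [a *m K = 0], and [K] is invertible because its square is
    [- 1%:M]. *)
Lemma symp_form_nondeg a : (forall b, a *m K *m b^T = 0) -> a = 0.
Proof.
move=> a0; have aK0 : a *m K = 0.
  apply/rowP => i; have /matrixP/(_ 0 0) := a0 (delta_mx 0 i).
  by rewrite trmx_delta -colE !mxE.
by apply: oppr_inj; rewrite oppr0 -[a]mulmx1 -mulmxN -symp_mx_sqr mulmxA aK0 mul0mx.
Qed.

(** The entries of [M *m K *m M^T] are the values of the transported form on pairs of basis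
    vectors. *)
Lemma symplecticP (M : 'M[F]_(2 * nu)) :
  reflect (forall a b, (a *m M) *m K *m (b *m M)^T = a *m K *m b^T)
          (symplectic_pred M).
Proof.
apply: (iffP eqP) => [MK a b|MK].
  by rewrite trmx_mul -!mulmxA (mulmxA K) (mulmxA M) (mulmxA M K) MK.
apply/matrixP => i j; have /matrixP/(_ 0 0) := MK (delta_mx 0 i) (delta_mx 0 j).
rewrite trmx_mul !mulmxA -(mulmxA (delta_mx 0 i)) -(mulmxA (delta_mx 0 i)).
by rewrite -!rowE trmx_delta -!colE !mxE.
Qed.

Definition symp_lfun T : 'End(V) := linfun (mulmxr (symplectic_val T)).

(** An invertible matrix has trivial kernel, so it maps lines to lines. *)
Lemma symp_img_dim T U : \dim (symp_lfun T @: val U)%VS == 1%N.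
Proof.
rewrite limg_dim_eq ?(valP U) //; apply/eqP; rewrite -subv0.
apply/subvP => a /memv_capP[_]; rewrite memv_ker lfunE /= memv0 => /eqP aT0.
by rewrite -[a](mulmxK (symplectic_unit T)) aT0 mul0mx.
Qed.

Definition symp_img T U : vertex := Sub (symp_lfun T @: val U)%VS (symp_img_dim T U).

Lemma symp_img_line T U a :
  val U = <[a]>%VS -> val (symp_img T U) = <[a *m symplectic_val T]>%VS.
Proof. by move=> Ua; rewrite /= Ua limg_line lfunE. Qed.

(** Matrices act on row vectors from the right, which matches the order of composition in [permM]:
    the action is a morphism, not an antimorphism. *)
Lemma symp_imgM S T U : symp_img (S * T)%g U = symp_img T (symp_img S U).
Proof.
have [a _ Ua] := symp_vertexP U; apply: val_inj.
by rewrite (symp_img_line _ Ua) (symp_img_line _ (symp_img_line _ Ua)) /= mulmxA.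
Qed.

Lemma symp_img1 U : symp_img 1%g U = U.
Proof.
have [a _ Ua] := symp_vertexP U; apply: val_inj.
by rewrite (symp_img_line _ Ua) /= mulmx1.
Qed.

Lemma symp_img_inj T : injective (symp_img T).
Proof.
by apply: (can_inj (g := symp_img T^-1%g)) => U; rewrite -symp_imgM mulgV symp_img1.
Qed.

Definition symp_perm T : {perm vertex} := perm (@symp_img_inj T).

Lemma symp_permM : {in [set: symplectic F nu] &, {morph symp_perm : S T / (S * T)%g}}.
Proof. by move=> S T _ _; apply/permP => U; rewrite permM !permE symp_imgM. Qed.

Canonical symp_perm_morphism := Morphism symp_permM.

Lemma symp_perm_aut T : symp_perm T \in graph_aut (@symp_adj F nu).
Proof.
apply/graph_autP => U W; rewrite !permE.
have [a _ Ua] := symp_vertexP U; have [b _ Wb] := symp_vertexP W.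
rewrite (symp_adjE Ua Wb) (symp_adjE (symp_img_line T Ua) (symp_img_line T Wb)).
by move/symplecticP: (valP T) => ->.
Qed.

Lemma symp_line_dim a : a != 0 -> \dim <[a]>%VS == 1%N.
Proof. by rewrite dim_vline => ->. Qed.

Definition symp_line a (a0 : a != 0) : vertex := Sub <[a]>%VS (symp_line_dim a0).

End SymplecticAction.

(** Adjacency only records whether the form vanishes; over ['F_2] this already determines its
    value. *)
Lemma F2_eq (x y : 'F_2) : (x != 0) = (y != 0) -> x = y.
Proof. by move: x y; do 2![case=> -[|[|?]] ?] => //= _; apply: val_inj. Qed.

Lemma mx11_F2_eq (x y : 'M['F_2]_1) : (x != 0) = (y != 0) -> x = y.
Proof.
have E (z : 'M['F_2]_1) : (z == 0) = (z 0 0 == 0).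
  apply/eqP/eqP => [->|z0]; first by rewrite mxE.
  by rewrite [z]mx11_scalar z0 raddf0.
by rewrite !E => /F2_eq xy; rewrite [x]mx11_scalar [y]mx11_scalar xy.
Qed.

Section BinarySymplectic.
Variable nu : nat.
Local Notation V := 'rV['F_2]_(2 * nu).
Local Notation K := (symp_mx 'F_2 nu).
Local Notation vertex := (symp_vertex 'F_2 nu).
Implicit Types (U : vertex) (a b : V).

Lemma vline_F2_inj a b : a != 0 -> (<[a]> = <[b]>)%VS -> a = b.
Proof.
move=> a0 ab; have /vlineP[k ak] : a \in <[b]>%VS by rewrite -ab memv_line.
have k0 : k != 0 by apply: contra_neq a0 => k0; rewrite ak k0 scale0r.
have k1 : k = 1 by apply: F2_eq; rewrite k0.
by rewrite ak k1 scale1r.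
Qed.

(** A matrix in the kernel fixes the line of each basis vector, hence the basis vector itself, so
    its rows are those of the identity. *)
Lemma symp_perm_inj : ('injm (@symp_perm 'F_2 nu))%g.
Proof.
apply/subsetP => T /morphpreP[_ /set1P T1]; apply/set1P/val_inj/row_matrixP => i.
rewrite !rowE mulmx1 /=; set a : V := delta_mx 0 i.
have a0 : a != 0.
  by apply/eqP => /matrixP/(_ 0 i)/eqP; rewrite !mxE !eqxx oner_eq0.
have Ua : val (symp_line a0) = <[a]>%VS by [].
apply/esym/vline_F2_inj => //; rewrite -(symp_img_line T Ua).
by move/permP: T1 => /(_ (symp_line a0)); rewrite permE perm1 => ->.
Qed.

Section Linearization.
Variables (s : {perm vertex}) (s_aut : s \in graph_aut (@symp_adj 'F_2 nu)).

(** The map [g] on vectors induced by [s]: [vpick] selects the only nonzero vector of the image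
    line. [insub] fails exactly when [a = 0], where the default gives [0]. *)
Definition aut_vect a : V :=
  if insub <[a]>%VS is Some U then vpick (val (s U)) else 0.

Lemma aut_vect0 : aut_vect 0 = 0.
Proof. by rewrite /aut_vect insubN //= dim_vline eqxx. Qed.

Lemma aut_vect_line U a : val U = <[a]>%VS -> val (s U) = <[aut_vect a]>%VS.
Proof.
move=> Ua; rewrite /aut_vect -Ua valK; move: (s U) => W.
have [b b0 Wb] := symp_vertexP W.
have pW0 : vpick (val W) != 0 by rewrite vpick0 Wb -dimv_eq0 dim_vline b0.
apply/esym/eqP; rewrite eqEdim -memvE memv_pick dim_vline pW0.
by rewrite (eqP (valP W)).
Qed.

Lemma aut_vect_eq0 a : (aut_vect a == 0) = (a == 0).
Proof.
have [->|a0] := eqVneq a 0; first by rewrite aut_vect0 eqxx.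
have /aut_vect_line sU : val (symp_line a0) = <[a]>%VS by [].
by have := valP (s (symp_line a0)); rewrite /= sU dim_vline; case: (aut_vect a == 0).
Qed.

Lemma aut_vect_form a b : aut_vect a *m K *m (aut_vect b)^T = a *m K *m b^T.
Proof.
have [->|a0] := eqVneq a 0; first by rewrite aut_vect0 !mul0mx.
have [->|b0] := eqVneq b 0; first by rewrite aut_vect0 !trmx0 !mulmx0.
have Ua : val (symp_line a0) = <[a]>%VS by [].
have Wb : val (symp_line b0) = <[b]>%VS by [].
have /graph_autP/(_ (symp_line a0) (symp_line b0)) := s_aut.
rewrite (symp_adjE Ua Wb) (symp_adjE (aut_vect_line Ua) (aut_vect_line Wb)).
exact: mx11_F2_eq.
Qed.

(** [s] is injective on lines, and a line determines its nonzero vector. *)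
Lemma aut_vect_inj : injective aut_vect.
Proof.
move=> a b ab; have [a0|a0] := eqVneq a 0.
  by apply/esym/eqP; rewrite a0 -aut_vect_eq0 -ab a0 aut_vect0.
have b0 : b != 0 by rewrite -aut_vect_eq0 -ab aut_vect_eq0.
have Ua : val (symp_line a0) = <[a]>%VS by [].
have Wb : val (symp_line b0) = <[b]>%VS by [].
apply: vline_F2_inj => //; rewrite -Ua -Wb; congr (val _).
by apply/(@perm_inj _ s)/val_inj; rewrite (aut_vect_line Ua) (aut_vect_line Wb) ab.
Qed.

Lemma aut_vect_linear : linear aut_vect.
Proof.
have D a b : aut_vect (a + b) = aut_vect a + aut_vect b.
  apply/eqP; rewrite -subr_eq0; apply/eqP/symp_form_nondeg => c.
  (* An injective self-map of a finite set is onto, so the test vector [c] is itself a value of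
     [aut_vect] and [aut_vect_form] applies to each term. *)
  have [g _ gK] := injF_bij aut_vect_inj.
  by rewrite -(gK c) !mulmxBl !mulmxDl !aut_vect_form !mulmxDl subrr.
move=> k a b; rewrite D; congr (_ + _).
(* The only scalars are 0 and 1, so homogeneity costs nothing beyond additivity. *)
have [->|k0] := eqVneq k 0; first by rewrite !scale0r aut_vect0.
by rewrite (_ : k = 1) ?scale1r //; apply: F2_eq; rewrite k0.
Qed.

Lemma symp_perm_surj : exists T, symp_perm T = s.
Proof.
(* The preimage of [s] is the matrix of the linear map [aut_vect]; it is symplectic since [aut_vect]
   preserves the form. *)
pose g : {linear V -> V} :=
  HB.pack aut_vect (GRing.isLinear.Build _ _ _ _ aut_vect aut_vect_linear).
have gE a : a *m lin1_mx g = aut_vect a by rewrite mul_rV_lin1.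
have Tg : symplectic_pred (lin1_mx g).
  by apply/symplecticP => a b; rewrite !gE aut_vect_form.
exists (Symplectic Tg); apply/permP => U; rewrite permE.
have [a _ Ua] := symp_vertexP U; apply: val_inj.
by rewrite (symp_img_line _ Ua) (aut_vect_line Ua) gE.
Qed.

End Linearization.
End BinarySymplectic.

Theorem proposition3p3 (nu : nat) (nu_ge1 : (1 <= nu)%N) :
  (graph_aut (@symp_adj 'F_2 nu) \isog [set: symplectic 'F_2 nu])%g.
Proof.
(* The isomorphism is built from matrices to automorphisms, hence the reversal. *)
rewrite isog_sym; apply/isogP; exists (symp_perm_morphism 'F_2 nu).
  exact: symp_perm_inj.
apply/setP => s; apply/idP/idP => [/morphimP[T _ _ ->]|/symp_perm_surj[T <-]].
  exact: symp_perm_aut.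
by apply: mem_morphim; rewrite inE.
Qed.
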